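(* Let $G$ be a finite group and $H$ a subgroup of $G$. If there exists a Sylow $2$-subgroup of $H$ which is a perfect code of $G$, then $H$ is a perfect code of $G$.
   Context: For a finite group $G$ with identity $1$ and a subset $S\subseteq G\setminus\{1\}$ with $S^{-1}=S$ (possibly $S=\emptyset$), the Cayley graph $\mathrm{Cay}(G,S)$ has vertex set $G$, with $x,y$ adjacent if and only if $yx^{-1}\in S$. A perfect code in a graph $\Gamma$ with vertex set $V$ is a subset $C\subseteq V$ such that no two vertices of $C$ are adjacent and every vertex in $V\setminus C$ is adjacent to exactly one vertex in $C$. A subset (in particular a subgroup) $C$ of $G$ is called a perfect code of $G$ if there exists such an $S$ for which $C$ is a perfect code in $\mathrm{Cay}(G,S)$. *)

(* Defs.v *)
From mathcomp Require Import all_boot all_fingroup all_solvable.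

Set Implicit Arguments.
Unset Strict Implicit.
Unset Printing Implicit Defensive.

Local Open Scope group_scope.

(* The graph has vertex set V and adjacency relation e restricted to V. *)
Definition perfect_code_in (T : finType) (V : {set T}) (e : rel T)
    (C : {set T}) : Prop :=
  [/\ C \subset V,
      {in C &, forall x y, ~~ e x y}
    & {in V :\: C, forall x, #|[set c in C | e x c]| = 1%N}].

Definition cayley_adj (gT : finGroupType) (S : {set gT}) : rel gT :=
  fun x y => y * x^-1 \in S.

(* S^-1 is the pointwise inverse of the set S, and G^# is G minus 1. *)
Definition perfect_code (gT : finGroupType) (G : {group gT})
    (C : {set gT}) : Prop :=
  exists S : {set gT},
    [/\ S \subset G^#, S^-1 = S & perfect_code_in G (cayley_adj S) C].

(* Main.v *)
Require Import Defs.
From mathcomp Require Import all_boot all_fingroup all_solvable.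

(** For x outside H, the neighbours of x in H correspond to the elements of
    S in the right coset H x^-1, so H is a perfect code exactly when some
    inverse-closed S picks one element from each nontrivial right coset of H
    and none from H itself ([perfect_codeP]).

    To build such an S, work inside the double cosets D = HxH.  Every right
    coset in D meets the inverse of every right coset in D^-1
    ([rcoset_pair]), so the right cosets of D can be matched arbitrarily with
    those of D^-1, each matched pair receiving some s and s^-1.  If D differs
    from D^-1 this works because the two contain equally many right cosets; if
    D = D^-1 it works when that number is even.  The one obstruction is a
    double coset D = D^-1 with an odd number of right cosets; it disappears
    if D contains an involution t, because the coset Ht can then be served by
    t alone ([inv_selector_exists]).

    The involution is supplied by the subgroup P.  Let D = D^-1 be a double
    coset of H with an odd number of right cosets of H.  Since H is a union
    of an odd number |H : P| of right cosets of P, D is a union of an odd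
    number of right cosets of P, all different from P.  The connection set S0
    witnessing that P is a perfect code meets each of them once, so S0 and D
    meet in an inverse-closed set of odd size, and inversion fixes a point of
    it ([inv_selector_fixed]).  The Sylow hypothesis enters through the
    oddness of |H : P| ([perfect_code_odd_index]). *)

Set Implicit Arguments.
Unset Strict Implicit.
Unset Printing Implicit Defensive.

Local Open Scope group_scope.

(** * Inverse-closed sets that select one element from each block *)

Lemma mem_inv_closed (gT : finGroupType) (S : {set gT}) (x : gT) :
  S^-1 = S -> (x^-1 \in S) = (x \in S).
Proof. by move=> {2}<-; rewrite mem_invg. Qed.

Lemma odd_inv_closed_fixed (gT : finGroupType) (A : {set gT}) :
  A^-1 = A -> odd #|A| -> exists2 t, t \in A & t^-1 = t.
Proof.
have [n] := ubnP #|A|; elim: n A => // n IHn A ltAn AV oddA.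
have /card_gt0P[x Ax]: 0 < #|A| by case: #|A| oddA.
have [xV | nxV] := eqVneq x^-1 x; first by exists x.
have AxV : x^-1 \in A :\ x by rewrite !inE nxV mem_inv_closed.
have cardA : #|A| = #|A :\ x :\ x^-1|.+2.
  by rewrite (cardsD1 x) Ax (cardsD1 x^-1) AxV.
have [||| t] := IHn (A :\ x :\ x^-1).
- by rewrite cardA in ltAn; apply: ltnW.
- apply/setP=> z; rewrite !inE !(mem_inv_closed _ AV) (inj_eq invg_inj).
  by rewrite -{2}[x]invgK (inj_eq invg_inj) !andbA [(z != x) && _]andbC.
- by rewrite cardA /= negbK in oddA.
by rewrite !inE => /and3P[_ _ At]; exists t.
Qed.

Lemma trivIset_eq (T : finType) (U : {set {set T}}) (A B : {set T}) (x : T) :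
  trivIset U -> A \in U -> B \in U -> x \in A -> x \in B -> A = B.
Proof.
move=> tiU UA UB Ax Bx.
by rewrite -(def_pblock tiU UA Ax) (def_pblock tiU UB Bx).
Qed.

(** For U the nontrivial right cosets of H, such an S is the connection set of
    a Cayley graph in which H is a perfect code. *)
Definition inv_selector (gT : finGroupType) (U : {set {set gT}}) (S : {set gT}) :=
  [/\ S^-1 = S, S \subset cover U
    & {in U, forall R : {set gT}, #|S :&: R| = 1%N}].

(** The step of the inductive construction: s and s^-1 serve the blocks R and
    R'.  Allowing R = R' when s is its own inverse covers at once the pairing
    of two blocks and the use of an involution for a single one. *)
Lemma inv_selector_extend (gT : finGroupType) (U : {set {set gT}})
    (R R' S : {set gT}) (s : gT) :
    trivIset U -> R \in U -> R' \in U -> s \in R -> s^-1 \in R' ->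
    (R = R' -> s^-1 = s) -> inv_selector (U :\ R :\ R') S ->
  inv_selector U (s |: (s^-1 |: S)).
Proof.
move=> tiU UR UR' Rs R's fixs [SV sSU selS].
have S_in z Q : Q \in U -> z \in S -> z \in Q -> Q \in U :\ R :\ R'.
  move=> UQ Sz Qz; have /bigcupP[Q' UQ' Q'z] := subsetP sSU z Sz.
  have UQ'0 : Q' \in U by move: UQ'; rewrite !inE => /and3P[].
  by rewrite (trivIset_eq tiU UQ UQ'0 Qz Q'z).
split.
- apply/setP=> z; rewrite !inE !(mem_inv_closed _ SV).
  have eqV u : (z^-1 == u) = (z == u^-1).
    by rewrite -[u in LHS]invgK (inj_eq invg_inj).
  by rewrite !eqV invgK orbCA.
- apply/subsetP=> z; rewrite !inE => /or3P[/eqP-> | /eqP-> | Sz].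
  + by apply/bigcupP; exists R.
  + by apply/bigcupP; exists R'.
  have /bigcupP[Q UQ Qz] := subsetP sSU z Sz.
  by apply/bigcupP; exists Q => //; move: UQ; rewrite !inE => /and3P[].
move=> Q UQ; have [eQR | neQR] := eqVneq Q R.
  rewrite eQR; apply/eqP/cards1P; exists s; apply/setP=> z; rewrite !inE.
  apply/andP/eqP=> [[/or3P[/eqP// | /eqP-> Rz | Sz Rz]] | ->].
  - by apply/fixs/(trivIset_eq tiU UR UR' Rz R's).
  - by have := S_in z R UR Sz Rz; rewrite !inE eqxx andbF.
  by rewrite eqxx.
have [eQR' | neQR'] := eqVneq Q R'.
  rewrite eQR'; apply/eqP/cards1P; exists s^-1; apply/setP=> z; rewrite !inE.
  apply/andP/eqP=> [[/or3P[/eqP-> R'z | /eqP// | Sz R'z]] | ->].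
  - by apply/esym/fixs/(trivIset_eq tiU UR UR' Rs R'z).
  - by have := S_in z R' UR' Sz R'z; rewrite !inE eqxx.
  by rewrite eqxx orbT.
rewrite -(selS Q); last by rewrite !inE neQR neQR'.
congr #|pred_of_set _|; apply/setP=> z; rewrite !inE.
have [->|_] := eqVneq z s.
  case Qs: (s \in Q); rewrite ?andbF //; case/eqP: neQR.
  exact: trivIset_eq tiU UQ UR Qs Rs.
have [->|//] := eqVneq z s^-1.
case Qs: (s^-1 \in Q); rewrite ?andbF //; case/eqP: neQR'.
exact: trivIset_eq tiU UQ UR' Qs R's.
Qed.

(** * Matching the right cosets of a double coset *)

Section Cosets.

Variables (gT : finGroupType) (H : {group gT}).
Implicit Types (U : {set {set gT}}) (D R S : {set gT}).

(** Since y lies in (HxH)^-1, y^-1 = s k with s in Hx and k in H, and then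
    s^-1 = k y lies in Hy. *)
Lemma rcoset_pair (x y : gT) :
  H :* y * H = (H :* x * H)^-1 ->
  exists2 s, s \in H :* x & s^-1 \in H :* y.
Proof.
move=> eqD; have: y \in H :* y * H.
  by rewrite -{1}[y]mulg1 mem_mulg ?rcoset_refl.
rewrite eqD mem_invg => /mulsgP[s k Hxs Hk yV]; exists s => //.
by rewrite mem_rcoset yV mulKg.
Qed.

(** The double coset of a right coset R = Hx is R * H, so for a double coset D
    these are the members of U inside D. *)
Definition cosets_of U D := [set R in U | R * H == D].

Lemma card_cosets_ofD1 U R D :
  R \in U ->
  #|cosets_of U D| = ((R * H == D)%g + #|cosets_of (U :\ R) D|)%N.
Proof.
move=> UR; rewrite (cardsD1 R) inE UR; congr (_ + #|pred_of_set _|).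
by apply/setP=> Q; rewrite !inE andbA.
Qed.

(** Induction on U, removing at each step either the coset of an involution,
    when R lies in a self-inverse D with an odd number of cosets left, or
    else R together with another coset R' of D^-1.  Both hypotheses pass to the
    smaller family: a step removes equally many cosets from E and E^-1, for
    any E, and leaves an even number in D whenever D = D^-1, so that each
    involution is asked for at most once. *)
Lemma inv_selector_exists (G : {group gT}) U :
    U \subset rcosets H G ->
    (forall D, #|cosets_of U D^-1| = #|cosets_of U D|) ->
    (forall D, D^-1 = D -> odd #|cosets_of U D| ->
       exists2 t, t^-1 = t & H :* t \in cosets_of U D) ->
  exists S, inv_selector U S.
Proof.
have [n] := ubnP #|U|; elim: n U => // n IHn U ltUn sUG symU oddU.
have tiU : trivIset U.
  have /and3P[_ tiH _] := rcosets_partition_mul G H.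
  exact: trivIsetS sUG tiH.
have [-> | /set0Pn[R UR]] := eqVneq U set0.
  exists set0; split=> [||R]; rewrite ?sub0set ?inE //.
  by apply/setP=> z; rewrite !inE.
have [x Gx defR] := rcosetsP (subsetP sUG R UR).
pose D := R * H.
have [/andP[/eqP DV oddD] | evenD] :=
    boolP ((D^-1 == D) && odd #|cosets_of U D|).
  have [t tV] := oddU D DV oddD; rewrite inE => /andP[Ut /eqP tD].
  have [|||| S selS] := IHn (U :\ (H :* t)).
  - by move: ltUn; rewrite (cardsD1 (H :* t)) Ut.
  - exact: subset_trans (subD1set _ _) sUG.
  - move=> E; have := symU E; rewrite !(card_cosets_ofD1 _ Ut) tD.
    by rewrite -{1}DV (inj_eq invg_inj) => /addnI.
  - move=> E EV; have [-> | neE] := eqVneq E D.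
      move: oddD; rewrite (card_cosets_ofD1 _ Ut) tD eqxx /=.
      by move/negPf->.
    have := oddU E EV; rewrite (card_cosets_ofD1 _ Ut) tD eq_sym (negPf neE).
    move=> odE /odE[u uV]; rewrite inE => /andP[Uu /eqP uE]; exists u => //.
    rewrite !inE Uu uE eqxx !andbT; apply: contraNneq neE => eut.
    by rewrite -uE eut tD.
  exists (t |: (t^-1 |: S)).
  apply: (inv_selector_extend (R := H :* t) (R' := H :* t)) => //.
  + exact: rcoset_refl.
  + by rewrite tV rcoset_refl.
  have -> // : U :\ (H :* t) :\ (H :* t) = U :\ (H :* t).
  by apply/setP=> Q; rewrite !inE; case: eqP.
(* A coset R' other than R is available: if D differs from D^-1 by the
   equality of the two counts, and otherwise by evenness. *)
have [R' UR' /eqP R'D] : exists2 R', R' \in U :\ R & R' * H == D^-1.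
  suff /card_gt0P[R']: 0 < #|cosets_of (U :\ R) D^-1|.
    by rewrite !inE -andbA => /and3P[neR UR' R'D]; exists R'; rewrite ?inE ?neR.
  have := symU D; rewrite !(card_cosets_ofD1 _ UR) -/D eqxx eq_sym.
  have [DV | _] := eqVneq D^-1 D; last by rewrite add0n => ->.
  move: evenD; rewrite DV eqxx (card_cosets_ofD1 _ UR) -/D eqxx /= negbK.
  by case: #|_|.
have [neR UR'0] : R' != R /\ R' \in U by move: UR'; rewrite !inE => /andP[].
have [y Gy defR'] := rcosetsP (subsetP sUG R' UR'0).
have [s Rs R's] : exists2 s, s \in R & s^-1 \in R'.
  by rewrite defR defR'; apply: rcoset_pair; rewrite -defR -defR'.
have cardU E : #|cosets_of U E|
    = ((D == E)%g + ((D^-1 == E)%g + #|cosets_of (U :\ R :\ R') E|))%N.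
  by rewrite (card_cosets_ofD1 _ UR) (card_cosets_ofD1 _ UR') R'D.
have [|||| S selS] := IHn (U :\ R :\ R').
- move: ltUn; rewrite (cardsD1 R) UR (cardsD1 R') UR' => ltUn.
  exact: ltnW.
- by apply: subset_trans sUG; rewrite !subDset subsetU // subsetUr orbT.
- move=> E; have := symU E; rewrite !cardU (inj_eq invg_inj).
  have -> : (D == E^-1) = (D^-1 == E) by rewrite -(inj_eq invg_inj) invgK.
  by rewrite addnCA => /addnI/addnI.
- move=> E EV; have [eDE | neE] := eqVneq E D.
    by move: evenD; rewrite -eDE EV eqxx cardU -eDE EV eqxx /= negbK => /negPf->.
  have neE' : D^-1 != E by rewrite -EV (inj_eq invg_inj) eq_sym.
  have := oddU E EV; rewrite cardU eq_sym (negPf neE) (negPf neE').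
  move=> odE /odE[u uV]; rewrite inE => /andP[Uu /eqP uE]; exists u => //.
  rewrite !inE Uu uE eqxx !andbT; apply/andP; split.
    by apply: contraNneq neE' => eut; rewrite -uE eut R'D.
  by apply: contraNneq neE => eut; rewrite -uE eut.
exists (s |: (s^-1 |: S)); apply: (inv_selector_extend (R := R) (R' := R')) => //.
by move=> eRR'; rewrite eRR' eqxx in neR.
Qed.

End Cosets.

(** * Perfect codes and their connection sets *)

Lemma card_rcosets_mul (gT : finGroupType) (H : {group gT}) (D : {set gT}) :
  H * D = D -> #|D| = (#|rcosets H D| * #|H|)%N.
Proof.
move=> HD; apply: card_uniform_partition.
  by move=> _ /rcosetsP[x _ ->]; rewrite card_rcoset.
apply/and3P; split.
- rewrite eqEsubset; apply/andP; split; apply/subsetP=> x.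
    case/bigcupP=> _ /rcosetsP[y Dy ->] Hyx.
    by rewrite -HD (subsetP (mulgS _ _) _ Hyx) ?sub1set.
  by move=> Dx; apply/bigcupP; exists (H :* x); rewrite ?rcoset_refl ?mem_rcosets ?HD.
- have /and3P[_ tiH _] := rcosets_partition_mul [set: gT] H.
  by apply: trivIsetS tiH; apply: imsetS; apply: subsetT.
by apply/rcosetsP=> -[x _ H0]; have := rcoset_refl H x; rewrite -H0 inE.
Qed.

(** The neighbours c of x in H are the c with c x^-1 in S, and c |-> c x^-1 maps
    them onto the elements of S in the coset H x^-1. *)
Lemma perfect_codeP (gT : finGroupType) (G H : {group gT}) :
    H \subset G ->
  perfect_code G H <-> exists S, inv_selector (rcosets H G :\ (H : {set gT})) S.
Proof.
move=> sHG.
have nbrE S x : #|[set c in H | cayley_adj S x c]| = #|S :&: H :* x^-1|.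
  rewrite -[LHS](card_rcoset _ x^-1); congr #|pred_of_set _|; apply/setP=> z.
  by rewrite mem_rcoset !inE mem_rcoset !invgK /cayley_adj mulgK andbC.
have in_cosets x : (H :* x \in rcosets H G :\ (H : {set gT})) = (x \in G :\: H).
  rewrite !inE mem_rcosets mulSGid //; congr (~~ _ && _).
  by apply/eqP/idP=> [<- | Hx]; rewrite ?rcoset_refl ?rcoset_id.
have cover_cosets : cover (rcosets H G :\ (H : {set gT})) = G :\: H.
  apply/setP=> x; apply/bigcupP/idP=> [[R UR] | GHx]; last first.
    by exists (H :* x); rewrite ?in_cosets ?rcoset_refl.
  have /rcosetsP[y _ defR]: R \in rcosets H G by case/setD1P: UR.
  by rewrite defR => /rcoset_eqP eqxy; rewrite -in_cosets eqxy -defR.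
split=> [[S [sSG SV [_ indep dom]]] | [S [SV sSU selS]]].
  exists S; split=> //.
    rewrite cover_cosets; apply/subsetP=> x Sx.
    have /setD1P[_ Gx] := subsetP sSG x Sx; rewrite inE Gx andbT.
    apply/negP=> Hx; have := indep 1 x (group1 H) Hx.
    by rewrite /cayley_adj invg1 mulg1 Sx.
  move=> R UR; have /rcosetsP[x _ defR]: R \in rcosets H G by case/setD1P: UR.
  move: UR; rewrite defR in_cosets => GHx.
  by rewrite -[x]invgK -nbrE; apply: dom; move: GHx; rewrite !inE !groupV.
rewrite cover_cosets in sSU.
exists S; split=> //.
  apply: subset_trans sSU _; apply/subsetP=> x; rewrite !inE => /andP[nHx ->].
  by rewrite andbT; apply: contraNneq nHx => ->; apply: group1.
split=> // [x y Hx Hy | x GHx].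
  apply/negP=> /(subsetP sSU); rewrite !inE => /andP[/negP[]].
  by rewrite groupM ?groupV.
by rewrite nbrE; apply: selS; rewrite in_cosets; move: GHx; rewrite !inE !groupV.
Qed.

(** As D avoids P and is a union of right cosets of P, S meets D in one element
    per coset: an inverse-closed set of odd size. *)
Lemma inv_selector_fixed (gT : finGroupType) (G P : {group gT}) (S D : {set gT}) :
    inv_selector (rcosets P G :\ (P : {set gT})) S ->
    D \subset G :\: P -> P * D = D -> D^-1 = D -> odd #|rcosets P D| ->
  exists2 t, t \in D & t^-1 = t.
Proof.
move=> [SV sSU selS] sDG PD DV oddD.
have nonP x : x \in D -> P :* x \in rcosets P G :\ (P : {set gT}).
  move=> Dx; have /setDP[Gx nPx] := subsetP sDG x Dx.
  rewrite !inE mem_rcosets (subsetP (mulG_subr _ _)) // andbT.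
  by apply: contraNneq nPx => <-; apply: rcoset_refl.
have [] := @odd_inv_closed_fixed _ (S :&: D).
- by apply/setP=> z; rewrite !inE !mem_inv_closed.
- suff cosetsSD : rcoset P @: (S :&: D) = rcosets P D.
    move: oddD; rewrite -cosetsSD card_in_imset // => x y /setIP[Sx Dx] /setIP[Sy _].
    rewrite !rcosetE => eqxy.
    have /eqP/cards1P[s defs] := selS _ (nonP x Dx).
    have: x \in S :&: P :* x by rewrite inE Sx rcoset_refl.
    have: y \in S :&: P :* x by rewrite inE Sy eqxy rcoset_refl.
    by rewrite defs !inE => /eqP-> /eqP.
  apply/eqP; rewrite eqEsubset imsetS ?subsetIr //=.
  apply/subsetP=> _ /rcosetsP[x Dx ->].
  have /eqP/cards1P[s defs] := selS _ (nonP x Dx).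
  have: s \in S :&: P :* x by rewrite defs inE.
  case/setIP=> Ss Pxs; apply/imsetP; exists s; last first.
    by rewrite rcosetE; apply/esym/rcoset_eqP.
  by rewrite inE Ss -PD (subsetP (mulgS _ _) _ Pxs) ?sub1set.
by move=> t /setIP[_ Dt] tV; exists t.
Qed.

(** The two hypotheses of [inv_selector_exists] are checked on the nontrivial
    right cosets of H.  Inversion preserves cardinality and |D| is |H| times
    the number of right cosets of H in D, hence the symmetry; for the same
    reason D has |H : P| times as many right cosets of P as of H, hence the
    parity required by [inv_selector_fixed]. *)
Lemma perfect_code_odd_index (gT : finGroupType) (G H P : {group gT}) :
    P \subset H -> H \subset G -> odd #|H : P| ->
  perfect_code G P -> perfect_code G H.
Proof.
move=> sPH sHG oddHP.
move/(perfect_codeP (subset_trans sPH sHG)) => [S0 selS0].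
apply/(perfect_codeP sHG).
pose U := rcosets H G :\ (H : {set gT}).
have cosets_ofE x : x \in G :\: H ->
    cosets_of H U (H :* x * H) = rcosets H (H :* x * H).
  case/setDP=> Gx nHx; apply/setP=> R; apply/idP/rcosetsP.
    rewrite inE => /andP[/setD1P[_ /rcosetsP[y Gy ->]] /eqP<-].
    by exists y; rewrite // -{1}[y]mulg1 mem_mulg ?rcoset_refl.
  case=> y /mulsgP[z k Hxz Hk ->] ->.
  have HzHx := rcoset_eqP Hxz.
  have Gz : z \in G.
    by move: Hxz; rewrite mem_rcoset => /(subsetP sHG); rewrite groupMr ?groupV.
  have nHz : z \notin H.
    apply: contra nHx => Hz.
    by rewrite -(rcoset_id Hz) HzHx rcoset_refl.
  have zkD : H :* (z * k) * H = H :* x * H.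
    by rewrite rcosetM -!mulgA lcoset_id // mulgA HzHx mulgA.
  rewrite inE zkD eqxx andbT rcosetM HzHx.
  rewrite 2!inE -HzHx -rcosetM mem_rcosets mulSGid //.
  rewrite groupM ?(subsetP sHG k) // andbT.
  by apply: contraNneq nHz => Hzk; rewrite -(groupMr z Hk) -Hzk rcoset_refl.
have card_dcoset x : x \in G :\: H ->
    (#|cosets_of H U (H :* x * H)%g| * #|H|)%N = #|(H :* x * H)%g|.
  by move=> GHx; rewrite cosets_ofE // -card_rcosets_mul // !mulgA mulGid.
have cosets_of_nil D : cosets_of H U D != set0 ->
    exists2 x, x \in G :\: H & D = H :* x * H.
  case/set0Pn=> R; rewrite inE => /andP[/setD1P[neRH UR] /eqP<-].
  have [x Gx defR] := rcosetsP UR.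
  exists x; rewrite ?defR // inE Gx andbT.
  by apply: contra neRH => Hx; rewrite defR rcoset_id.
have inv_dcoset x : (H :* x * H)^-1 = H :* x^-1 * H.
  by rewrite invMg invg_rcoset invGid mulgA.
have sym_dcoset x : x \in G :\: H ->
    #|cosets_of H U (H :* x * H)^-1| = #|cosets_of H U (H :* x * H)|.
  move=> GHx; apply/eqP; rewrite -(eqn_pmul2r (cardG_gt0 H)) card_dcoset //.
  rewrite inv_dcoset card_dcoset -?inv_dcoset ?card_invg //.
  by move: GHx; rewrite !inE !groupV.
apply: (@inv_selector_exists _ H G); first exact: subD1set.
- move=> D; have [D0 | /cosets_of_nil[x GHx ->]] := eqVneq (cosets_of H U D) set0.
    have [-> | /cosets_of_nil[x GHx eqD]] := eqVneq (cosets_of H U D^-1) set0.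
      by rewrite D0.
    by rewrite -[D in RHS]invgK eqD sym_dcoset.
  exact: sym_dcoset.
move=> D DV oddD.
have [x GHx defD] : exists2 x, x \in G :\: H & D = H :* x * H.
  by apply: cosets_of_nil; apply: contraTneq oddD => ->; rewrite cards0.
have sDGH : D \subset G :\: H.
  apply/subsetP=> y Dy.
  have: H :* y \in rcosets H D by apply/rcosetsP; exists y.
  rewrite defD -cosets_ofE // inE => /andP[/setD1P[neH]].
  rewrite mem_rcosets mulSGid // inE => -> _; rewrite andbT.
  by apply: contra neH => Hy; rewrite rcoset_id.
have HD : H * D = D by rewrite defD !mulgA mulGid.
have PD : P * D = D by rewrite -HD mulgA mulSGid.
have [t Dt tV] : exists2 t, t \in D & t^-1 = t.
  apply: (inv_selector_fixed selS0 _ PD DV).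
    exact: subset_trans (setDS _ sPH).
  suff -> : #|rcosets P D| = (#|cosets_of H U D| * #|H : P|)%N.
    by rewrite oddM oddD.
  apply/eqP; rewrite -(eqn_pmul2r (cardG_gt0 P)) -(card_rcosets_mul PD).
  by rewrite -mulnA [(#|H : P| * _)%N]mulnC Lagrange // defD card_dcoset.
by exists t; rewrite // defD cosets_ofE // -defD; apply/rcosetsP; exists t.
Qed.

Theorem theorem4p2 (gT : finGroupType) (G H : {group gT}) (sHG : H \subset G)
    (hP : exists2 P : {group gT}, 2.-Sylow(H) P & perfect_code G P) :
  perfect_code G H.
Proof.
have [P sylP codeP] := hP.
apply: perfect_code_odd_index (pHall_sub sylP) sHG _ codeP.
by rewrite odd_2'nat; case/and3P: sylP.
Qed.
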